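(* Let $q$ be a prime power, $m\ge2$ an integer, and $g(x)=x^m+\sum_{i=2}^{m-1}a_ix^i$ with $a_i\in\mathbb{F}_q$. If $g$ is a permutation polynomial of $\mathbb{F}_q$, then there are $q^2(q-1)$ linearized polynomials $L(x)$ over $\mathbb{F}_{q^2}$ of rank $1$ such that $g(x^q+x)+L(x)$ is a (normalized) permutation polynomial of $\mathbb{F}_{q^2}$.
   Context: A linearized polynomial over $\mathbb{F}_{q^2}$ is $L(x)=\alpha_1x^q+\alpha_0x$ with $\alpha_0,\alpha_1\in\mathbb{F}_{q^2}$; its rank is that of the $\mathbb{F}_q$-linear evaluation map on $\mathbb{F}_{q^2}$. A permutation polynomial of a finite field is one whose evaluation map is a bijection; ''normalized'' means monic and mapping $0$ to $0$. *)

(* Defs.v *)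
From HB Require Import structures.
From mathcomp Require Import all_boot all_order all_fingroup all_algebra all_solvable all_field.

Set Implicit Arguments.
Unset Strict Implicit.
Unset Printing Implicit Defensive.

Import GRing.Theory.
Local Open Scope ring_scope.

Definition perm_poly (R : nzRingType) (p : {poly R}) : Prop :=
  bijective (fun x : R => p.[x]).

Definition normalized (R : nzRingType) (p : {poly R}) : bool :=
  (p \is monic) && (p.[0] == 0).

Definition linpoly (R : nzRingType) (q : nat) (a1 a0 : R) : {poly R} :=
  a1 *: 'X^q + a0 *: 'X.

Definition linearized (R : nzRingType) (q : nat) (L : {poly R}) : Prop :=
  exists a1 a0 : R, L = linpoly q a1 a0.

(* Meaningful only when x |-> p.[x] is K-linear, as it is for linearized
   polynomials by lfun_linpolyE below; otherwise linfun does not agree with it. *)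
Definition eval_rank (K : fieldType) (E : fieldExtType K) (p : {poly E}) : nat :=
  \dim (limg (linfun (fun x : E => p.[x]))).

Lemma linpoly_linear (K : finFieldType) (E : fieldExtType K) (a1 a0 : E) :
  linear (fun x : E => (linpoly #|K| a1 a0).[x]).
Proof.
have [p _ pcharK] := finPcharP K.
have pcharE : p \in [pchar E]%R by rewrite pchar_lalg.
have natq : ([pchar E]%R).-nat #|K|.
  rewrite (eq_pnat _ (pcharf_eq pcharE)) -cardsT.
  by have /and3P[] := fin_ring_pchar_abelem pcharK.
move=> c x y; rewrite /linpoly !hornerE.
rewrite exprDn_pchar // exprZn expf_card !mulrDr -!scalerAr scalerDr.
by rewrite addrACA !addrA.
Qed.

Lemma lfun_linpolyE (K : finFieldType) (E : fieldExtType K) (a1 a0 : E) :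
  linfun (fun x : E => (linpoly #|K| a1 a0).[x])
    =1 (fun x : E => (linpoly #|K| a1 a0).[x]).
Proof.
pose H := GRing.isLinear.Build K E E *:%R _ (linpoly_linear a1 a0).
pose f : {linear E -> E} := HB.pack (fun x : E => (linpoly #|K| a1 a0).[x]) H.
exact: (lfunE f).
Qed.

(* Main.v *)
(** A rank 1 linearized polynomial is [c * Tr (b * x)] with [c, b] nonzero and
    [Tr x = x^q + x].  As [x |-> (Tr x, Tr (b * x))] is a bijection from E to
    K^2 exactly when [b] is not in K, and as [(t, s) |-> g(t) + c * s] is a
    bijection from K^2 to E exactly when [c] is not in K, the polynomials L to
    count are the pairs [(c, b)] of elements of E \ K up to
    [(c, b) ~ (c / r, r * b)] with [r] in K^*.  For a fixed [theta] in E \ K,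
    each class has one representative with [c] in [theta + K]; this leaves [q]
    choices for [c] and [q^2 - q] choices for [b]. *)

Require Import Defs.
From mathcomp Require Import all_boot all_order all_algebra all_field.
From mathcomp Require Import ring.
Import GRing.Theory.
Local Open Scope ring_scope.

Set Implicit Arguments.
Unset Strict Implicit.

(** * The Frobenius map and the trace of E over K *)

Lemma expfD_card (K : finFieldType) (E : fieldExtType K) (x y : E) :
  (x + y) ^+ #|K| = x ^+ #|K| + y ^+ #|K|.
Proof.
have := linpoly_linear 1 0 1 x y.
by rewrite /linpoly !hornerE !scale1r /= addr0.
Qed.

Lemma expfB_card (K : finFieldType) (E : fieldExtType K) (x y : E) :
  (x - y) ^+ #|K| = x ^+ #|K| - y ^+ #|K|.
Proof. by apply/(addIr (y ^+ #|K|)); rewrite subrK -expfD_card subrK. Qed.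

Lemma mem1_expf_card (K : finFieldType) (E : fieldExtType K) (x : E) :
  (x \in 1%VS) = (x ^+ #|K| == x).
Proof. by rewrite (Fermat's_little_theorem 1%AS) /= dimv1. Qed.

Lemma expf_card2 (K : finFieldType) (E : fieldExtType K) (x : E) :
  \dim {:E} = 2%N -> x ^+ #|K| ^+ #|K| = x.
Proof.
move=> dimE; apply/eqP; rewrite -exprM mulnn -dimE.
by rewrite -(Fermat's_little_theorem {:E}%AS) memvf.
Qed.

Lemma inj_perm_poly (K : finFieldType) (E : fieldExtType K) (p : {poly E}) :
  injective (fun x => p.[x]) -> perm_poly p.
Proof. exact: (@injF_bij (finvect_type E)). Qed.

Lemma linpoly_inj (R : nzRingType) (q : nat) (a1 a0 b1 b0 : R) :
  (1 < q)%N -> linpoly q a1 a0 = linpoly q b1 b0 -> a1 = b1 /\ a0 = b0.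
Proof.
move=> q_gt1 eqL; have ne1q : (1 == q)%N = false by rewrite ltn_eqF.
have := congr1 (coefp q) eqL; have := congr1 (coefp 1%N) eqL.
rewrite /= !coefD !coefZ !coefXn !coefX !eqxx [q == 1%N]eq_sym ne1q.
by rewrite !mulr0 !mulr1 !addr0 !add0r.
Qed.

Definition qtrace (K : finFieldType) (E : fieldExtType K) (x : E) : E :=
  x ^+ #|K| + x.

(** This is [c * qtrace (b * x)] as a polynomial in [x], with its two coefficients written out so
    that it is linearized by definition and can be compared coefficientwise. *)
Definition tracepoly (K : finFieldType) (E : fieldExtType K) (c b : E) :
  {poly E} := linpoly #|K| (c * b ^+ #|K|) (c * b).

Lemma qtraceB (K : finFieldType) (E : fieldExtType K) (x y : E) :
  qtrace (x - y) = qtrace x - qtrace y.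
Proof. by rewrite /qtrace expfB_card opprD addrACA. Qed.

(** In a quadratic extension the Frobenius map is an involution, so it swaps the two summands of the
    trace. *)
Lemma qtrace_mem1 (K : finFieldType) (E : fieldExtType K) (x : E) :
  \dim {:E} = 2%N -> qtrace x \in 1%VS.
Proof.
by move=> dimE; rewrite mem1_expf_card /qtrace expfD_card expf_card2 // addrC.
Qed.

Lemma horner_tracepoly (K : finFieldType) (E : fieldExtType K) (c b x : E) :
  (tracepoly c b).[x] = c * qtrace (b * x).
Proof. by rewrite /tracepoly /linpoly !hornerE /qtrace exprMn; ring. Qed.

(** * Linearized polynomials of rank 1 *)

Lemma linpoly_eq0 (K : finFieldType) (E : fieldExtType K)
    (theta a1 a0 : E) :
  theta \notin 1%VS ->
  (linpoly #|K| a1 a0).[1] = 0 -> (linpoly #|K| a1 a0).[theta] = 0 ->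
  a1 = 0 /\ a0 = 0.
Proof.
rewrite mem1_expf_card /linpoly !hornerE expr1n !mulr1 => /negP Kth a10 ath0.
have a0E : a0 = - a1 by apply/eqP; rewrite -addr_eq0 addrC a10.
suff a1_0 : a1 = 0 by rewrite a0E a1_0 oppr0.
(* With [a0 = - a1], the value at [theta] is [a1 * (theta ^+ q - theta)], where the second factor is
   nonzero because [theta] is outside K. *)
apply/eqP/negP => /negP a1_neq0; case: Kth; rewrite -subr_eq0.
by rewrite -(mulrI_eq0 _ (mulfI a1_neq0)) mulrBr -mulNr -a0E ath0.
Qed.

Lemma dim2_gen (K : finFieldType) (E : fieldExtType K) :
  \dim {:E} = 2%N -> exists2 theta : E, theta \notin 1%VS &
    forall x : E, exists u v : K, x = u%:A + v *: theta.
Proof.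
move=> dimE.
have [theta _ Kth] : exists2 theta : E, theta \in {:E}%VS & theta \notin 1%VS.
  by apply/subvPn; apply/negP=> /dimvS; rewrite dimE dimv1.
exists theta => // x.
have capth : (1 :&: <[theta]> = 0)%VS.
  apply/eqP; rewrite -subv0; apply/subvP=> y /memv_capP[y1 /vlineP[k yE]].
  move: y1; rewrite yE rpredZeq (negPf Kth) orbF => /eqP->.
  by rewrite scale0r mem0v.
have : x \in (1 + <[theta]>)%VS.
  suff /eqP-> : (1 + <[theta]> == {:E})%VS by rewrite memvf.
  rewrite eqEdim subvf dimE dimv_disjoint_sum // dimv1 dim_vline.
  by case: eqP Kth => // ->; rewrite mem0v.
case/memv_addP=> _ /vlineP[u ->] [_ /vlineP[v ->] ->].
by exists u, v.
Qed.

(** Traces lie in K, so the image is contained in the line of [c]. It is not zero, since a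
    linearized polynomial vanishing at 1 and [theta] has both coefficients zero, whereas [c * b] is
    nonzero. *)
Lemma tracepoly_rank (K : finFieldType) (E : fieldExtType K) (c b : E) :
  \dim {:E} = 2%N -> c != 0 -> b != 0 -> eval_rank (tracepoly c b) = 1%N.
Proof.
move=> dimE c0 b0; have [theta Kth _] := dim2_gen dimE.
rewrite /eval_rank; set f := linfun _.
have fE x : f x = c * qtrace (b * x).
  by rewrite -horner_tracepoly /f lfun_linpolyE.
have sub : (limg f <= <[c]>)%VS.
  apply/subvP=> _ /memv_imgP[x _ ->]; rewrite fE.
  by have /vlineP[k ->] := qtrace_mem1 (b * x) dimE;
    apply/vlineP; exists k; rewrite -scalerAr mulr1.
apply/anti_leq; have := dimvS sub; rewrite dim_vline c0 => -> /=.
rewrite lt0n dimv_eq0; apply/negP=> /eqP img0.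
have f0 x : (tracepoly c b).[x] = 0.
  rewrite horner_tracepoly -fE; apply/eqP; rewrite -memv0 -img0.
  exact/memv_img/memvf.
have [_ /eqP] := linpoly_eq0 Kth (f0 1) (f0 theta).
by rewrite mulf_eq0 (negPf c0) (negPf b0).
Qed.

(** Values in K are fixed by Frobenius, so [L(x)^q - L(x)] vanishes on E. Reduced by [x^(q^2) = x],
    it is again linearized, hence its coefficients are zero. *)
Lemma linpoly_into_base (K : finFieldType) (E : fieldExtType K) (a1 a0 : E) :
  \dim {:E} = 2%N -> (forall x, (linpoly #|K| a1 a0).[x] \in 1%VS) ->
  a1 = a0 ^+ #|K|.
Proof.
move=> dimE in1; have [theta Kth _] := dim2_gen dimE.
have fix0 x : (linpoly #|K| (a0 ^+ #|K| - a1) (a1 ^+ #|K| - a0)).[x] = 0.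
  have := in1 x; rewrite mem1_expf_card /linpoly !hornerE => /eqP.
  rewrite expfD_card !exprMn expf_card2 // => fixx.
  apply/eqP; rewrite -(subrr (a1 * x ^+ #|K| + a0 * x)) -{1}fixx; apply/eqP.
  by ring.
by have [/subr0_eq <-] := linpoly_eq0 Kth (fix0 1) (fix0 theta).
Qed.

Lemma linearized_rank1 (K : finFieldType) (E : fieldExtType K) (L : {poly E}) :
  \dim {:E} = 2%N -> linearized #|K| L -> eval_rank L = 1%N ->
  exists c b : E, [/\ c != 0, b != 0 & L = tracepoly c b].
Proof.
move=> dimE [a1 [a0 ->]].
rewrite /eval_rank; set f := linfun _ => dimf.
have fE x : f x = (linpoly #|K| a1 a0).[x] by rewrite /f lfun_linpolyE.
pose c := vpick (limg f).
have c0 : c != 0 by rewrite vpick0 -dimv_eq0 dimf.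
have imgE : limg f = <[c]>%VS.
  by apply/esym/eqP; rewrite eqEdim -memvE memv_pick dimf dim_vline c0.
(* The image is the line of [c], so [L / c] takes values in K. This makes it the trace of [d0 * x],
   with [d0] its coefficient of [x]. *)
have val1 x : (linpoly #|K| (a1 / c) (a0 / c)).[x] \in 1%VS.
  have : f x \in limg f by exact/memv_img/memvf.
  rewrite imgE => /vlineP[k fx]; apply/vlineP; exists k.
  apply: (mulfI c0); rewrite -scalerAr mulr1 -fx fE /linpoly !hornerE.
  by field.
pose d0 := a0 / c; have e1 := linpoly_into_base dimE val1.
have LE : linpoly #|K| a1 a0 = tracepoly c d0.
  by rewrite /tracepoly -e1 /d0 !(mulrC c) !divfK.
exists c, d0; split => //.
apply/eqP => d00; move: dimf; suff -> : limg f = 0%VS by rewrite dimv0.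
apply/eqP; rewrite -subv0; apply/subvP=> _ /memv_imgP[x _ ->].
rewrite fE LE horner_tracepoly d00 mul0r /qtrace expr0n.
by rewrite (gtn_eqF (ltnW (finNzRing_gt1 K))) addr0 mulr0 mem0v.
Qed.

(** * The permutation criterion *)

Lemma ker_qtrace (K : finFieldType) (E : fieldExtType K) (b x : E) :
  b \notin 1%VS -> qtrace x = 0 -> qtrace (b * x) = 0 -> x = 0.
Proof.
rewrite mem1_expf_card /qtrace => Kb tr0 trb0; apply/eqP/negP => /negP x0.
have : (b ^+ #|K| - b) * x = 0.
  (* Eliminating [x ^+ q] between the two trace equations leaves a nonzero multiple of [x]. *)
  have -> : (b ^+ #|K| - b) * x =
    b ^+ #|K| * (x ^+ #|K| + x) - ((b * x) ^+ #|K| + b * x).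
    by rewrite exprMn; ring.
  by rewrite tr0 trb0 mulr0 subrr.
by move/eqP; rewrite mulf_eq0 subr_eq0 (negPf Kb) (negPf x0).
Qed.

Lemma horner_comp_trace (K : finFieldType) (E : fieldExtType K)
    (g : {poly K}) (L : {poly E}) (x : E) :
  (map_poly (in_alg E) g \Po ('X^#|K| + 'X) + L).[x]
    = (map_poly (in_alg E) g).[qtrace x] + L.[x].
Proof. by rewrite !hornerE horner_comp !hornerE. Qed.

Lemma horner_in_alg (K : finFieldType) (E : fieldExtType K)
    (g : {poly K}) (k : K) :
  (map_poly (in_alg E) g).[k%:A] = g.[k]%:A.
Proof. exact: (horner_map (in_alg E)). Qed.

Lemma perm_poly_comp_trace (K : finFieldType) (E : fieldExtType K)
    (g : {poly K}) (c b : E) :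
  \dim {:E} = 2%N -> perm_poly g ->
  perm_poly (map_poly (in_alg E) g \Po ('X^#|K| + 'X) + tracepoly c b)
    <-> c \notin 1%VS /\ b \notin 1%VS.
Proof.
move=> dimE permg; split=> [permf | [Kc Kb]].
  have [theta Kth _] := dim2_gen dimE.
  split; apply/negP=> in1.
    (* If [c] is in K, every value of the polynomial is in K, so [theta] is not attained. *)
    have [h _ hK] := permf; move/negP: Kth; apply.
    rewrite -[theta]hK horner_comp_trace horner_tracepoly.
    have [/vlineP[t ->] /vlineP[u ->]] := (qtrace_mem1 (h theta) dimE,
      qtrace_mem1 (b * h theta) dimE).
    by rewrite horner_in_alg rpredD ?rpredM // rpredZ // mem1v.
  (* This [x] is a nonzero element of trace 0. If [b] is in K, then [b * x] has trace 0 too, so [x]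
     and 0 have the same image. *)
  pose x := theta ^+ #|K| - theta.
  have trx : qtrace x = 0.
    by rewrite /qtrace expfB_card expf_card2 // addrC subrKA subrr.
  have trbx : qtrace (b * x) = 0.
    move: in1; rewrite mem1_expf_card => /eqP bq.
    by rewrite /qtrace exprMn bq -mulrDr [_ + _]trx mulr0.
  have tr0 : qtrace (0 : E) = 0 by have := qtraceB (0 : E) 0; rewrite !subrr.
  have : x = 0.
    apply: (bij_inj permf); rewrite !horner_comp_trace !horner_tracepoly.
    by rewrite trx trbx !mulr0 tr0 mulr0.
  by move/eqP; rewrite subr_eq0 -mem1_expf_card (negPf Kth).
apply: inj_perm_poly => x y.
rewrite !horner_comp_trace !horner_tracepoly => fxy.
have [/vlineP[t tE] /vlineP[u uE]] := (qtrace_mem1 x dimE, qtrace_mem1 y dimE).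
have /vlineP[d dE] := qtrace_mem1 (b * (y - x)) dimE.
(* Equal values at [x] and [y] put a K-multiple of [c] into K. As [c] is outside K, the factor [d]
   is 0, and then injectivity of [g] gives equal traces. *)
have : d *: c = (g.[t] - g.[u])%:A.
  rewrite -[c]mulr1 scalerAr -dE mulrBr qtraceB mulrBr scalerBl -!horner_in_alg.
  by rewrite -tE -uE (canRL (addKr _) (esym fxy)); ring.
move=> dc; have d0 : d = 0.
  apply/eqP; move: (Kc); apply: contraNT => d0.
  by rewrite -[c](scalerK d0) dc !rpredZ ?mem1v.
move: dc; rewrite d0 scale0r => /esym/eqP.
rewrite scaler_eq0 oner_eq0 orbF subr_eq0 => /eqP gtu.
have tu : t = u := bij_inj permg gtu.
apply/esym/eqP; rewrite -subr_eq0; apply/eqP; apply: (ker_qtrace Kb).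
  by rewrite qtraceB uE tE tu subrr.
by rewrite dE d0 scale0r.
Qed.

(** * Normalization *)

Lemma normalized_comp_trace (K : finFieldType) (E : fieldExtType K)
    (g : {poly K}) (a1 a0 : E) :
  g \is monic -> g.[0] = 0 -> (2 < size g)%N ->
  normalized (map_poly (in_alg E) g \Po ('X^#|K| + 'X) + linpoly #|K| a1 a0).
Proof.
move=> mong g0 sz; have q1 := finNzRing_gt1 K.
have qN0 : 0 ^+ #|K| = 0 :> E by rewrite expr0n (gtn_eqF (ltnW q1)).
have szX : size ('X^#|K| + 'X : {poly E}) = #|K|.+1.
  by rewrite size_polyDl size_polyXn // size_polyX.
have lcX : lead_coef ('X^#|K| + 'X : {poly E}) = 1.
  by rewrite lead_coefDl ?lead_coefXn // size_polyXn size_polyX.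
have mcomp : map_poly (in_alg E) g \Po ('X^#|K| + 'X) \is monic.
  rewrite monicE lead_coef_comp ?szX ?ltnS ?(ltnW q1) // lcX expr1n mulr1.
  by rewrite -monicE map_monic.
apply/andP; split; last first.
  by rewrite horner_comp_trace /linpoly !hornerE /qtrace qN0 addr0
    -(scale0r 1) horner_in_alg g0 scale0r /= mulr0 !addr0.
rewrite monicE lead_coefDl ?(eqP mcomp) //.
have szL : (size (linpoly #|K| a1 a0) <= #|K|.+1)%N.
  rewrite (leq_trans (size_polyD _ _)) // geq_max.
  rewrite !(leq_trans (size_scale_leq _ _)) ?size_polyXn ?size_polyX //.
  exact: ltnW.
apply: leq_ltn_trans szL _.
have := size_comp_poly (map_poly (in_alg E) g) ('X^#|K| + 'X).
rewrite szX size_map_poly /= => sc.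
(* As [g] has degree at least 2, the composition has degree above [q], and adding [L] leaves its
   leading term unchanged. *)
have : (#|K| < (size g).-1 * #|K|)%N.
  rewrite -{1}[#|K|]mul1n ltn_pmul2r ?(ltnW q1) // -ltnS prednK //.
  by rewrite (ltn_trans _ sz).
rewrite -sc; by case: (size _).
Qed.

(** * Unique representatives of the pairs (c, b) *)

Lemma tracepoly_normal_form (K : finFieldType) (E : fieldExtType K)
    (theta c b : E) :
  (forall x : E, exists u v : K, x = u%:A + v *: theta) ->
  c \notin 1%VS -> b \notin 1%VS ->
  exists (k u v : K), v != 0 /\
    tracepoly c b = tracepoly (theta + k%:A) (u%:A + v *: theta).
Proof.
move=> gen Kc Kb; have [w [r cE]] := gen c.
have r0 : r != 0.
  by apply: contraNneq Kc => r0; rewrite cE r0 scale0r addr0 rpredZ ?mem1v.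
have [u [v bE]] := gen (r *: b).
have v0 : v != 0.
  apply: contraNneq Kb => v0; rewrite -[b](scalerK r0) bE v0 scale0r addr0.
  by rewrite !rpredZ ?mem1v.
(* Dividing [c] by its [theta]-coordinate [r] brings it into [theta + K]. Multiplying [b] by [r]
   compensates in both coefficients, because [r ^+ q = r]. *)
exists (r^-1 * w), u, v; split=> //.
have -> : theta + (r^-1 * w)%:A = r^-1 *: c.
  by rewrite cE scalerDr !scalerA mulVf // scale1r addrC.
rewrite -bE /tracepoly exprZn expf_card.
by rewrite -!scalerAl -!scalerAr !scalerA mulVf // !scale1r.
Qed.

(** The quotient of the two coefficient equations shows that [b / b'] is fixed by Frobenius, so
    [b = r b'] with [r] in K. Then [r (theta + k) = theta + k'], and the [theta]-coordinate forces
    [r = 1]. *)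
Lemma tracepoly_inj (K : finFieldType) (E : fieldExtType K)
    (theta : E) (k k' : K) (b b' : E) :
  theta \notin 1%VS -> b != 0 -> b' != 0 ->
  tracepoly (theta + k%:A) b = tracepoly (theta + k'%:A) b' ->
  k = k' /\ b = b'.
Proof.
move=> Kth b0 b'0 /(linpoly_inj (finNzRing_gt1 K))[eq1 eq0].
have shift0 l : theta + l%:A != 0.
  apply: contraNneq Kth => /eqP; rewrite addr_eq0 => /eqP->.
  by rewrite rpredN rpredZ ?mem1v.
have : b / b' \in 1%VS.
  rewrite mem1_expf_card exprMn exprVn; apply/eqP.
  apply: (mulfI (shift0 k)); rewrite !mulrA eq1 eq0.
  by rewrite !mulfK // expf_neq0.
case/vlineP=> r /(canRL (divfK b'0)); rewrite -scalerAl mul1r => bE.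
have thr : (1 - r) *: theta \in 1%VS.
  have : (theta + k%:A) * r%:A = theta + k'%:A.
    by apply: (mulIf b'0); rewrite -eq0 bE -mulrA -scalerAl mul1r.
  rewrite mulrDl -!scalerAr !mulr1 => thE.
  have -> : (1 - r) *: theta = r *: k%:A - k'%:A.
    rewrite scalerBl scale1r; apply: subr0_eq.
    by rewrite -(subrr (theta + k'%:A)) -{2}thE; ring.
  by rewrite rpredB // !rpredZ ?mem1v.
move: thr; rewrite rpredZeq (negPf Kth) orbF subr_eq0 => /eqP r1.
move: eq0; rewrite bE -r1 scale1r => /(mulIf b'0)/addrI/eqP.
by rewrite -subr_eq0 -scalerBl scaler_eq0 oner_eq0 orbF subr_eq0 => /eqP.
Qed.

Lemma basis_coord_inj (K : finFieldType) (E : fieldExtType K)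
    (theta : E) (u v u' v' : K) :
  theta \notin 1%VS -> u%:A + v *: theta = u'%:A + v' *: theta ->
  u = u' /\ v = v'.
Proof.
move=> Kth e.
have : (v - v') *: theta \in 1%VS.
  have -> : (v - v') *: theta = u'%:A - u%:A.
    by rewrite scalerBl (canRL (addKr _) e); ring.
  by rewrite rpredB // rpredZ ?mem1v.
rewrite rpredZeq (negPf Kth) orbF subr_eq0 => /eqP vv.
split=> //; move: e; rewrite vv => /addIr/eqP.
by rewrite -subr_eq0 -scalerBl scaler_eq0 oner_eq0 orbF subr_eq0 => /eqP.
Qed.

(** * The enumeration *)

Theorem theorem9 (q : nat) (K : finFieldType) (E : fieldExtType K)
    (cardK : #|K| = q) (dimE : \dim {:E} = 2%N)
    (m : nat) (m_ge2 : (2 <= m)%N) (a : nat -> K) :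
  let g : {poly K} := 'X^m + \sum_(2 <= i < m) a i *: 'X^i in
  let f (L : {poly E}) : {poly E} :=
    map_poly (in_alg E) g \Po ('X^q + 'X) + L in
  perm_poly g ->
  exists s : seq {poly E},
    [/\ uniq s,
        size s = (q ^ 2 * (q - 1))%N,
        forall L : {poly E},
          L \in s <-> [/\ linearized q L, eval_rank L = 1%N & perm_poly (f L)]
      & forall L : {poly E}, L \in s -> normalized (f L)].
Proof.
move=> g f permg; have [theta Kth gen] := dim2_gen dimE.
rewrite {}/f; case: q / cardK.
have szs : (size (\sum_(2 <= i < m) a i *: 'X^i)%R < size ('X^m : {poly K}))%N.
  rewrite size_polyXn ltnS big_nat; elim/big_ind: _.
  - by rewrite size_poly0.
  - by move=> p r sp sr; rewrite (leq_trans (size_polyD _ _)) // geq_max sp.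
  - move=> i /andP[_ im]; rewrite (leq_trans (size_scale_leq _ _)) //.
    by rewrite size_polyXn.
have szg : size g = m.+1 by rewrite size_polyDl // size_polyXn.
have mong : g \is monic by rewrite monicE lead_coefDl // lead_coefXn.
have g0 : g.[0] = 0.
  rewrite hornerD hornerXn horner_sum expr0n (gtn_eqF (ltnW m_ge2)) add0r.
  rewrite big_nat big1 // => i /andP[i2 _].
  by rewrite hornerZ hornerXn expr0n (gtn_eqF (ltnW i2)) mulr0.
(* Taking [v] among the units keeps [bb u v] outside K, and makes the index type of [F] have exactly
   [q * q * (q - 1)] elements. *)
pose bb (u : K) (v : {unit K}) : E := u%:A + FinRing.uval v *: theta.
pose F (t : K * K * {unit K}) : {poly E} :=
  tracepoly (theta + t.1.1%:A) (bb t.1.2 t.2).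
have unit0 (v : {unit K}) : FinRing.uval v != 0 by rewrite -unitfE (valP v).
have K1 (k : K) : k%:A \in (1%VS : {vspace E}) by rewrite rpredZ ?mem1v.
have Kb u v : bb u v \notin 1%VS.
  by rewrite rpredDl // rpredZeq (negPf (unit0 v)).
have Kc (k : K) : theta + k%:A \notin 1%VS.
  by rewrite rpredDr.
have neq0 (x : E) : x \notin 1%VS -> x != 0.
  by apply: contraNneq => ->; rewrite mem0v.
have Finj : injective F.
  move=> [[k u] v] [[k' u'] v'] /tracepoly_inj[]; rewrite ?neq0 //= => ->.
  by move=> /(basis_coord_inj Kth)[-> /val_inj->].
exists (codom F); split.
- by rewrite /codom/image_mem map_inj_uniq ?enum_uniq.
- rewrite size_codom !card_prod -(cardsT {unit K}) card_finField_unit.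
  by rewrite mulnn subn1.
- move=> L; split=> [/codomP[[[k u] v] ->] | [linL rkL permL]].
    split; first by do 2!eexists.
      by apply: tracepoly_rank; rewrite ?neq0.
    exact/perm_poly_comp_trace.
  have [c [b [c0 b0 LE]]] := linearized_rank1 dimE linL rkL.
  move: permL; rewrite LE => /perm_poly_comp_trace-/(_ dimE permg)[Kc' Kb'].
  have [k [u [v [v0 ->]]]] := tracepoly_normal_form gen Kc' Kb'.
  (* The nonzero [theta]-coordinate is repackaged as a unit to give a preimage under [F]. *)
  have vU : v \is a GRing.unit by rewrite unitfE.
  by apply/codomP; exists (k, u, FinRing.unit K vU).
- by move=> L /codomP[t ->]; apply: normalized_comp_trace; rewrite ?szg.
Qed.
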